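(* Let $A$ and $B$ be two asynchronously composable IOTSes that are weakly asynchronously compatible. If the asynchronous system $A\otimes_{as}B$ is half-duplex, then $A\otimes B$ is synchronously deadlock-free if and only if $A\otimes_{as}B$ is asynchronously deadlock-free.
   Context: An IOTS $A=(\mathit{states}_A,\mathit{start}_A,\mathit{act}_A,\to_A)$ has states, initial state, actions $\mathit{act}_A=\mathit{in}_A\cup\mathit{out}_A\cup\mathit{int}_A$ (disjoint union of inputs, outputs, internal actions) and transitions $s\xrightarrow{a}_A s'$. $s\ (\xrightarrow{X})^*_A\ s'$ denotes a possibly empty finite sequence of transitions labelled in $X$; $\mathit{reach}(A)$ is the set of states reachable from $\mathit{start}_A$. $A,B$ are composable if $\mathit{act}_A\cap\mathit{act}_B=(\mathit{in}_A\cap\mathit{out}_B)\cup(\mathit{in}_B\cap\mathit{out}_A)=:\mathit{shared}(A,B)$. Synchronous composition $A\otimes B$: states $\mathit{states}_A\times\mathit{states}_B$, initial $(\mathit{start}_A,\mathit{start}_B)$, inputs $(\mathit{in}_A\cup\mathit{in}_B)\setminus\mathit{shared}(A,B)$, outputs $(\mathit{out}_A\cup\mathit{out}_B)\setminus\mathit{shared}(A,B)$, internal $\mathit{int}_A\cup\mathit{int}_B\cup\mathit{shared}(A,B)$; a non-shared action of one component moves only that component; a shared action $a$ yields $(s,t)\xrightarrow{a}(s',t')$ when $s\xrightarrow{a}_A s'$ and $t\xrightarrow{a}_B t'$. For a set $M$, $M^\rhd=\{a^\rhd\mid a\in M\}$ are fresh names. $A,B$ are asynchronously composable if composable and $\mathit{shared}(A,B)^\rhd\cap(\mathit{act}_A\cup\mathit{act}_B)=\emptyset$.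 With $\mathit{out}_{AB}=\mathit{out}_A\cap\mathit{in}_B$, $\Omega(A)$ is the IOTS with states $(s,q)$, $s\in\mathit{states}_A$, $q\in\mathit{out}_{AB}^*$, initial $(\mathit{start}_A,\epsilon)$, inputs $\mathit{in}_A$, outputs $\mathit{out}_A$, internal actions $\mathit{int}_A\cup\mathit{out}_{AB}^\rhd$, transitions $(s,q)\xrightarrow{a}(s',q)$ if $s\xrightarrow{a}_A s'$, $a\notin\mathit{out}_{AB}$; $(s,q)\xrightarrow{a^\rhd}(s',qa)$ if $s\xrightarrow{a}_A s'$, $a\in\mathit{out}_{AB}$; $(s,aq)\xrightarrow{a}(s,q)$ for $a\in\mathit{out}_{AB}$. $\Omega(B)$ analogously with $\mathit{out}_{BA}=\mathit{out}_B\cap\mathit{in}_A$. $A\otimes_{as}B=\Omega(A)\otimes\Omega(B)$; it is half-duplex if every reachable state $((s_A,q_A),(s_B,q_B))$ has $q_A=\epsilon$ or $q_B=\epsilon$. IOTSes $C,D$ are weakly synchronously compatible if composable and for all $(s_C,s_D)\in\mathit{reach}(C\otimes D)$ and $a\in\mathit{out}_C\cap\mathit{in}_D$ with $s_C\xrightarrow{a}_C s_C'$ there exist $\bar s_D,s_D'$ with $s_D\ (\xrightarrow{\mathit{int}_D})^*_D\ \bar s_D\xrightarrow{a}_D s_D'$, and symmetrically. $A,B$ are weakly asynchronously compatible if $\Omega(A)$ and $\Omega(B)$ are weakly synchronously compatible. A deadlock state of $A\otimes B$ is a reachable state of $A\otimes B$ with no outgoing transition; $A\otimes B$ is synchronously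 deadlock-free if it has no deadlock state. A deadlock state of $A\otimes_{as}B$ is a reachable state of $\Omega(A)\otimes\Omega(B)$ with no outgoing transition; $A\otimes_{as}B$ is asynchronously deadlock-free if it has none. *)

(* Defs.v *)
From Stdlib Require Import Relation_Operators.
From mathcomp Require Import all_boot.
From mathcomp Require Import boolp classical_sets.

Set Implicit Arguments.
Unset Strict Implicit.
Unset Printing Implicit Defensive.

Local Open Scope classical_set_scope.

(* The bare data of an IOTS. Composition and queue extension are defined on
   bare data; the lemmas below show that they yield IOTSes whenever the
   operands are (asynchronously) composable. *)
Record iots_data (Act : Type) := IotsData {
  state : Type;
  start : state;
  inp : set Act;
  out : set Act;
  internal : set Act;
  trans : state -> Act -> state -> Prop }.

Arguments start {Act} _.
Arguments inp {Act} _.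
Arguments out {Act} _.
Arguments internal {Act} _.
Arguments trans {Act} _ _ _ _.

Definition act (Act : Type) (A : iots_data Act) : set Act :=
  inp A `|` out A `|` internal A.

Definition is_iots (Act : Type) (A : iots_data Act) : Prop :=
  [/\ inp A `&` out A = set0,
      inp A `&` internal A = set0,
      out A `&` internal A = set0 &
      forall s a s', trans A s a s' -> act A a].

Record iots (Act : Type) := Iots {
  iots_dataOf :> iots_data Act;
  iotsP : is_iots iots_dataOf }.

Definition steps (Act : Type) (A : iots_data Act) (X : set Act) :
    state A -> state A -> Prop :=
  clos_refl_trans_1n (state A) (fun s s' => exists2 a, X a & trans A s a s').

Definition reach (Act : Type) (A : iots_data Act) : set (state A) :=
  [set s | steps (act A) (start A) s].

Definition shared (Act : Type) (A B : iots_data Act) : set Act :=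
  (inp A `&` out B) `|` (inp B `&` out A).

Definition composable (Act : Type) (A B : iots_data Act) : Prop :=
  act A `&` act B = shared A B.

Inductive sync_trans (Act : Type) (A B : iots_data Act) :
    state A * state B -> Act -> state A * state B -> Prop :=
| SyncLeft s a s' t of ~ shared A B a & trans A s a s' :
    sync_trans (s, t) a (s', t)
| SyncRight s t a t' of ~ shared A B a & trans B t a t' :
    sync_trans (s, t) a (s, t')
| SyncShared s t a s' t' of
    shared A B a & trans A s a s' & trans B t a t' :
    sync_trans (s, t) a (s', t').

Definition sync (Act : Type) (A B : iots_data Act) : iots_data Act := {|
  state := (state A * state B)%type;
  start := (start A, start B);
  inp := (inp A `|` inp B) `\` shared A B;
  out := (out A `|` out B) `\` shared A B;
  internal := internal A `|` internal B `|` shared A B;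
  trans := @sync_trans Act A B |}.

(* out_AB *)
Definition out_to (Act : Type) (A B : iots_data Act) : set Act :=
  out A `&` inp B.

(* [rhd a] is the name of the internal action that puts [a] into an output
   queue. All names live in one universe [Act], in which [rhd] is assumed to be
   injective; its freshness is only what [async_composable] requires. *)
Definition async_composable (Act : Type) (rhd : Act -> Act)
    (A B : iots_data Act) : Prop :=
  composable A B /\ (rhd @` shared A B) `&` (act A `|` act B) = set0.

(* Queues are words over the subtype of actions in [out_to A B]; the head of
   the sequence is the oldest element. *)
Inductive omega_trans (Act : Type) (rhd : Act -> Act) (A B : iots_data Act) :
    state A * seq (out_to A B) -> Act -> state A * seq (out_to A B) -> Prop :=
| OmegaMove s a s' q of trans A s a s' & ~ out_to A B a :
    omega_trans rhd (s, q) a (s', q)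
| OmegaEnqueue s (a : out_to A B) s' q of trans A s (val a) s' :
    omega_trans rhd (s, q) (rhd (val a)) (s', rcons q a)
| OmegaDequeue s (a : out_to A B) q :
    omega_trans rhd (s, a :: q) (val a) (s, q).

(* [omega rhd A B] is Omega(A) and [omega rhd B A] is Omega(B). *)
Definition omega (Act : Type) (rhd : Act -> Act) (A B : iots_data Act) :
    iots_data Act := {|
  state := (state A * seq (out_to A B))%type;
  start := (start A, [::]);
  inp := inp A;
  out := out A;
  internal := internal A `|` rhd @` out_to A B;
  trans := @omega_trans Act rhd A B |}.

Definition async (Act : Type) (rhd : Act -> Act) (A B : iots_data Act) :
    iots_data Act :=
  sync (omega rhd A B) (omega rhd B A).

Definition half_duplex (Act : Type) (rhd : Act -> Act) (A B : iots_data Act) :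
    Prop :=
  forall (sA : state A) (qA : seq (out_to A B))
         (sB : state B) (qB : seq (out_to B A)),
    @reach Act (async rhd A B) ((sA, qA), (sB, qB)) -> qA = [::] \/ qB = [::].

Definition weakly_sync_compatible (Act : Type) (C D : iots_data Act) : Prop :=
  [/\ composable C D,
      forall (sC : state C) (sD : state D) (a : Act) (sC' : state C),
        @reach Act (sync C D) (sC, sD) -> (out C `&` inp D) a ->
        trans C sC a sC' ->
        exists sD1 sD' : state D, steps (internal D) sD sD1 /\ trans D sD1 a sD'
    & forall (sC : state C) (sD : state D) (a : Act) (sD' : state D),
        @reach Act (sync C D) (sC, sD) -> (out D `&` inp C) a ->
        trans D sD a sD' ->
        exists sC1 sC' : state C, steps (internal C) sC sC1 /\ trans C sC1 a sC'].

Definition weakly_async_compatible (Act : Type) (rhd : Act -> Act)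
    (A B : iots_data Act) : Prop :=
  weakly_sync_compatible (omega rhd A B) (omega rhd B A).

Definition deadlock_state (Act : Type) (A : iots_data Act) : set (state A) :=
  [set s | reach s /\ ~ exists a s', trans A s a s'].

Definition deadlock_free (Act : Type) (A : iots_data Act) : Prop :=
  ~ exists s : state A, deadlock_state s.

Definition sync_deadlock_free (Act : Type) (A B : iots_data Act) : Prop :=
  deadlock_free (sync A B).

Definition async_deadlock_free (Act : Type) (rhd : Act -> Act)
    (A B : iots_data Act) : Prop :=
  deadlock_free (async rhd A B).

Lemma is_iots_sync (Act : Type) (A B : iots_data Act) :
  is_iots A -> is_iots B -> composable A B -> is_iots (sync A B).
Proof.
move=> [Aio Aii Aoi At] [Bio Bii Boi Bt] AB.
have ABE a : act A a -> act B a -> shared A B a by rewrite -AB; split.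
have dis (X Y : set Act) a : X `&` Y = set0 -> X a -> Y a -> False.
  by move=> XY Xa Ya; have : (X `&` Y) a by []; rewrite XY.
split=> /=.
- rewrite -subset0 => a [[[iA|iB] ns] [[oA|oB] _]].
  + exact: dis Aio iA oA.
  + by apply: ns; left.
  + by apply: ns; right.
  + exact: dis Bio iB oB.
- rewrite -subset0 => a [[[iA|iB] ns] [[iiA|iiB]|//]].
  + exact: dis Aii iA iiA.
  + by apply/ns/ABE; [left; left|right].
  + by apply/ns/ABE; [right|left; left].
  + exact: dis Bii iB iiB.
- rewrite -subset0 => a [[[oA|oB] ns] [[iiA|iiB]|//]].
  + exact: dis Aoi oA iiA.
  + by apply/ns/ABE; [left; right|right].
  + by apply/ns/ABE; [right|left; right].
  + exact: dis Boi oB iiB.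
- have inj a : act A a \/ act B a -> act (sync A B) a.
    have [sh _|ns] := pselect (shared A B a); first by right; right.
    case=> [[[iA|oA]|iiA]|[[iB|oB]|iiB]].
    + by left; left; split=> //; left.
    + by left; right; split=> //; left.
    + by right; left; left.
    + by left; left; split=> //; right.
    + by left; right; split=> //; right.
    + by right; left; right.
  move=> s a s' H; apply: inj; case: H => [? ? ? ? _ /At|? ? ? ? _ /Bt|? ? ? ? ? _ /At]; by [left|right].
Qed.

Lemma is_iots_omega (Act : Type) (rhd : Act -> Act) (A B : iots_data Act) :
  is_iots A -> async_composable rhd A B -> is_iots (omega rhd A B).
Proof.
move=> [Aio Aii Aoi At] [_ fresh].
have dis (X Y : set Act) a : X `&` Y = set0 -> X a -> Y a -> False.
  by move=> XY Xa Ya; have : (X `&` Y) a by []; rewrite XY.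
have freshA a : (rhd @` out_to A B) a -> act A a -> False.
  move=> [b [oA iB] <-] bA; apply: (dis _ _ _ fresh); last by left; exact: bA.
  by exists b => //; right.
split=> //=.
- rewrite -subset0 => a [iA [iiA|ra]]; first exact: dis Aii iA iiA.
  by apply: freshA ra _; left; left.
- rewrite -subset0 => a [oA [iiA|ra]]; first exact: dis Aoi oA iiA.
  by apply: freshA ra _; left; right.
- move=> s a s' [{}s {}a {}s' q /At [[?|?]|?] _|{}s b {}s' q _|{}s b q].
  + by left; left.
  + by left; right.
  + by right; left.
  + by right; right; exists (val b) => //; apply: set_valP.
  + by left; right; have [] := set_valP b.
Qed.

Lemma composable_omega (Act : Type) (rhd : Act -> Act) (A B : iots_data Act) :
  injective rhd -> is_iots A -> is_iots B -> async_composable rhd A B ->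
  composable (omega rhd A B) (omega rhd B A).
Proof.
move=> rhdI [Aio _ _ _] _ [AB fresh].
have freshS a : shared A B a -> act A (rhd a) \/ act B (rhd a) -> False.
  move=> sa ra; have : ((rhd @` shared A B) `&` (act A `|` act B)) (rhd a).
    by split=> //; exists a.
  by rewrite fresh.
rewrite /composable; have -> : shared (omega rhd A B) (omega rhd B A) = shared A B by [].
have omE (C D : iots_data Act) a :
    act (omega rhd C D) a <-> act C a \/ (rhd @` out_to C D) a.
  split; first by case=> [[?|?]|[?|?]]; [left; left; left|left; left; right
    |left; right|right].
  by case=> [[[?|?]|?]|?]; [left; left|left; right|right; left|right; right].
apply/seteqP; split=> a; last first.
  by rewrite -AB => -[aA aB]; split; apply/omE; left.
case=> /omE [aA|[b [oA iB] <-]] /omE [aB|[c [oB iA]]].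
- by rewrite -AB.
- by move=> ca; case: (@freshS c); [left|left; rewrite ca].
- by case: (@freshS b); [right|right].
- move=> /rhdI cb; move: oA iA; rewrite cb => oA iA.
  by have : (inp A `&` out A) b by []; rewrite Aio.
Qed.

(* Main.v *)
Require Import Defs.
From Stdlib Require Import Relation_Operators Operators_Properties.
From mathcomp Require Import all_boot.
From mathcomp Require Import boolp classical_sets.

Set Implicit Arguments.
Unset Strict Implicit.
Unset Printing Implicit Defensive.

Local Open Scope classical_set_scope.

(** In a half-duplex system every reachable asynchronous state, say with an
    empty queue at [B], arises from a reachable synchronous state [(r, sB)] by
    letting [A] run ahead alone from [r], emitting exactly the contents of its
    queue. So reachable asynchronous states with empty queues are the reachable
    synchronous ones, and a state with a nonempty queue is no deadlock since
    compatibility lets the receiver progress. Conversely, at a synchronous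
    deadlock only an enqueuing could be asynchronously possible; the progress
    that compatibility then grants the receiver is either a synchronous
    transition or an enqueuing in the opposite direction, against
    half-duplexity. *)

(** * Reachability and deadlock-freeness *)

Lemma reach_start (Act : Type) (A : iots_data Act) : reach (start A).
Proof. exact: rt1n_refl. Qed.

Lemma reach_step (Act : Type) (A : iots_data Act) s a s' :
  is_iots A -> reach s -> trans A s a s' -> reach s'.
Proof.
move=> [_ _ _ At] rs tr; apply/clos_rt_rt1n_iff.
apply: rt_trans; first exact/clos_rt_rt1n_iff/rs.
by apply: rt_step; exists a => //; apply: At tr.
Qed.

(** [steps] peels off the first transition, which would move the start state during an induction.
    Passing to the closure that peels off the last transition keeps it fixed. *)
Lemma reach_ind (Act : Type) (A : iots_data Act) (P : state A -> Prop) :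
  P (start A) ->
  (forall s a s', reach s -> P s -> trans A s a s' -> P s') ->
  forall s, reach s -> P s.
Proof.
move=> P0 PS s /clos_rt_rt1n_iff/clos_rt_rtn1_iff; elim=> // s1 s2 [a _ tr].
by move=> /clos_rt_rtn1_iff/clos_rt_rt1n_iff rs1 Ps1; apply: PS tr.
Qed.

Lemma deadlock_freeP (Act : Type) (A : iots_data Act) :
  deadlock_free A <-> forall s, reach s -> exists a s', trans A s a s'.
Proof.
split=> [df s rs|en [s [rs []]]]; last exact: en.
by apply: contrapT => ns; apply: df; exists s.
Qed.

(** * Shared actions and exchange of the two components *)

Lemma shared_sym (Act : Type) (A B : iots_data Act) : shared A B = shared B A.
Proof. by rewrite /shared setUC. Qed.

Lemma shared_out_to (Act : Type) (A B : iots_data Act) a :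
  shared A B a <-> out_to A B a \/ out_to B A a.
Proof. by split=> [[[? ?]|[? ?]]|[[? ?]|[? ?]]]; [right|left|right|left]. Qed.

Lemma internal_nshared (Act : Type) (A B : iots_data Act) a :
  is_iots A -> internal A a -> ~ shared A B a.
Proof.
move=> [_ Aii Aoi _] ia [[iA _]|[_ oA]].
- by have : (inp A `&` internal A) a by []; rewrite Aii.
- by have : (out A `&` internal A) a by []; rewrite Aoi.
Qed.

Lemma out_to_nout_to (Act : Type) (A B : iots_data Act) a :
  is_iots A -> out_to A B a -> ~ out_to B A a.
Proof.
by move=> [Aio _ _ _] [oA _] [_ iA]; have : (inp A `&` out A) a by []; rewrite Aio.
Qed.

Lemma val_shared (Act : Type) (A B : iots_data Act) (a : out_to A B) :
  shared A B (val a).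
Proof. by apply/shared_out_to; left; apply: set_valP. Qed.

Lemma sync_trans_swap (Act : Type) (A B : iots_data Act) s t a s' t' :
  sync_trans (A := A) (B := B) (s, t) a (s', t') ->
  sync_trans (A := B) (B := A) (t, s) a (t', s').
Proof.
move=> H; inversion H; subst.
- by apply: SyncRight; rewrite // shared_sym.
- by apply: SyncLeft; rewrite // shared_sym.
- by apply: SyncShared; rewrite // shared_sym.
Qed.

Lemma reach_sync_swap (Act : Type) (A B : iots_data Act) s t :
  @reach Act (sync A B) (s, t) -> @reach Act (sync B A) (t, s).
Proof.
have actE : act (sync A B) = act (sync B A).
  rewrite /act /= shared_sym [inp A `|` _]setUC [out A `|` _]setUC.
  by rewrite [internal A `|` _]setUC.
suff H (u v : state (sync A B)) : steps (act (sync A B)) u v ->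
    @steps Act (sync B A) (act (sync B A)) (u.2, u.1) (v.2, v.1) by move/H.
elim=> [w|[s1 t1] [s2 t2] w [a Xa tr] _ IH]; first exact: rt1n_refl.
apply: Relation_Operators.rt1n_trans IH; exists a; first by rewrite -actE.
exact: sync_trans_swap.
Qed.

Lemma composable_sym (Act : Type) (A B : iots_data Act) :
  composable A B -> composable B A.
Proof. by rewrite /composable setIC shared_sym. Qed.

Lemma async_composable_sym (Act : Type) (rhd : Act -> Act)
    (A B : iots_data Act) :
  async_composable rhd A B -> async_composable rhd B A.
Proof.
move=> [AB fresh]; split; first exact: composable_sym.
by rewrite shared_sym [act B `|` _]setUC.
Qed.

Lemma weakly_sync_compatible_sym (Act : Type) (A B : iots_data Act) :
  weakly_sync_compatible A B -> weakly_sync_compatible B A.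
Proof.
move=> [AB cA cB]; split; first exact: composable_sym.
- by move=> sB sA a sB' /reach_sync_swap rs; apply: cB rs.
- by move=> sB sA a sA' /reach_sync_swap rs; apply: cA rs.
Qed.

Lemma half_duplex_sym (Act : Type) (rhd : Act -> Act) (A B : iots_data Act) :
  half_duplex rhd A B -> half_duplex rhd B A.
Proof.
by move=> hd sB qB sA qA /reach_sync_swap /hd [->|->]; [right|left].
Qed.

Lemma is_iots_async (Act : Type) (rhd : Act -> Act) (rhd_inj : injective rhd)
    (A B : iots_data Act) :
  is_iots A -> is_iots B -> async_composable rhd A B ->
  is_iots (async rhd A B).
Proof.
move=> iA iB AB; apply: is_iots_sync; first exact: is_iots_omega.
- exact/is_iots_omega/async_composable_sym.
- exact: composable_omega.
Qed.

(** * One component running ahead of the other *)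

Lemma rhd_nshared (Act : Type) (rhd : Act -> Act) (A B : iots_data Act) a :
  async_composable rhd A B -> shared A B a -> ~ shared A B (rhd a).
Proof.
move=> [AB fresh] sa sra.
have : (rhd @` shared A B `&` (act A `|` act B)) (rhd a).
  (* By composability a shared name is an action of [A], which freshness forbids for [rhd a]. *)
  by split; [exists a|left; move: sra; rewrite -AB => -[]].
by rewrite fresh.
Qed.

(** Solo runs of [A] from [r], with the outputs to [B] recorded in queue order. Inputs from [B] are
    shared and not in [out_to A B], so they cannot occur. *)
Inductive emits (Act : Type) (A B : iots_data Act) (r : state A) :
    seq (out_to A B) -> state A -> Prop :=
| EmitsNil : emits r [::] r
| EmitsMove q s a s' of emits r q s & ~ shared A B a & trans A s a s' :
    emits r q s'
| EmitsOut q s (a : out_to A B) s' of emits r q s & trans A s (val a) s' :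
    emits r (rcons q a) s'.

(** The run is cut at its first emission; this is what delivering the head of a queue requires. In
    the induction, the last emission is also the first one exactly when nothing was emitted before
    it. *)
Lemma emits_cons (Act : Type) (A B : iots_data Act) (r s : state A)
    (a : out_to A B) q :
  emits r (a :: q) s ->
  exists r1 r2, [/\ @emits _ A B r [::] r1, trans A r1 (val a) r2 & emits r2 q s].
Proof.
move: {-1}(a :: q) (erefl (a :: q)) => q' eq_q' em.
elim: em a q eq_q' => [//|q0 s0 b s' em0 IH nsh tr a q /IH [r1 [r2 [? ? em2]]]|].
  by exists r1, r2; split=> //; apply: EmitsMove em2 nsh tr.
move=> [|c q0] s0 b s' em0 IH tr a q.
  by case=> -> ->; exists s0, s'; split=> //; apply: EmitsNil.
case=> -> ->; have [r1 [r2 [? ? em2]]] := IH c q0 erefl.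
by exists r1, r2; split=> //; apply: EmitsOut em2 tr.
Qed.

Lemma reach_emits_nil (Act : Type) (A B : iots_data Act) (r s : state A)
    (t : state B) :
  is_iots (sync A B) -> @reach Act (sync A B) (r, t) ->
  @emits _ A B r [::] s -> @reach Act (sync A B) (s, t).
Proof.
move=> iAB rr em; move: {-1}[::] (erefl (Nil (out_to A B))) em => q eq_q em.
elim: em eq_q => [//|q0 s0 a s' _ IH nsh tr /IH rs|[|? ?] //].
by apply: (reach_step iAB rs); apply: SyncLeft tr.
Qed.

(** The state [r] is a past state of [A] at which none of the outputs still queued has been sent. *)
Definition runs_ahead (Act : Type) (A B : iots_data Act) (sA : state A)
    (qA : seq (out_to A B)) (sB : state B) : Prop :=
  exists2 r, emits r qA sA & @reach Act (sync A B) (r, sB).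

(** Solo steps of [A] prolong its run, while an unshared move of [B] can be performed before that
    run, at [r]. A delivery turns the first emission of the run into a synchronization, and the rest
    of the run starts after it. *)
Lemma runs_ahead_step (Act : Type) (rhd : Act -> Act) (A B : iots_data Act)
    sA qA sB a sA' qA' sB' qB' :
  is_iots (sync A B) -> async_composable rhd A B ->
  runs_ahead sA qA sB ->
  trans (async rhd A B) ((sA, qA), (sB, [::])) a ((sA', qA'), (sB', qB')) ->
  qA' = [::] \/ qB' = [::] ->
  (qB' = [::] /\ runs_ahead sA' qA' sB') \/
  (qA' = [::] /\ runs_ahead sB' qB' sA').
Proof.
move=> iAB AB [r em rr] tr hd; inversion tr as
  [? ? ? ? nsh trA|? ? ? ? nsh trB|? ? ? ? ? sh trA trB]; subst.
- left; split=> //; inversion trA; subst.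
  + by exists r => //; apply: EmitsMove em nsh _.
  + by exists r => //; apply: EmitsOut em _.
  + by case: nsh; apply: val_shared.
- inversion trB as [? ? ? ? trB' nout|? b ? ? trB'|]; subst.
  + left; split=> //; exists r => //.
    by apply: (reach_step iAB rr); apply: SyncRight trB'.
  (* [B] enqueues, so the queue of [A] is empty and its run is silent, hence synchronously
     performable. The roles switch: [B] now runs ahead from [sB] by one emission. *)
  + case: hd => // qA0; subst; right; split=> //; exists sB.
      exact: (EmitsOut (EmitsNil A sB) trB').
    exact/reach_sync_swap/(reach_emits_nil iAB rr em).
- inversion trB as [? ? ? ? trB' nout|? b|]; subst; last first.
    case: (@rhd_nshared _ rhd A B (val b)) => //.
    by rewrite shared_sym; apply: val_shared.
  left; split=> //; inversion trA as [? ? ? ? ? nout'|? b|]; subst.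
  + by case/shared_out_to: sh.
  + by case: (@rhd_nshared _ rhd A B (val b)) => //; apply: val_shared.
  + have [r1 [r2 [em1 tr1 em2]]] := emits_cons em; exists r2 => //.
    apply: (reach_step iAB (reach_emits_nil iAB rr em1)).
    by apply: SyncShared tr1 trB'; apply: val_shared.
Qed.

Lemma reach_async_runs_ahead (Act : Type) (rhd : Act -> Act)
    (rhd_inj : injective rhd) (A B : iots_data Act) sA qA sB qB :
  is_iots A -> is_iots B -> async_composable rhd A B -> half_duplex rhd A B ->
  @reach Act (async rhd A B) ((sA, qA), (sB, qB)) ->
  (qB = [::] /\ runs_ahead sA qA sB) \/ (qA = [::] /\ runs_ahead sB qB sA).
Proof.
move=> iA iB AB hd.
have iAB : is_iots (sync A B) by apply: is_iots_sync => //; case: AB.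
have iBA : is_iots (sync B A).
  by apply: is_iots_sync => //; apply: composable_sym; case: AB.
have iAs := is_iots_async rhd_inj iA iB AB.
pose P (u : state (async rhd A B)) :=
  (u.2.2 = [::] /\ runs_ahead u.1.1 u.1.2 u.2.1) \/
  (u.1.2 = [::] /\ runs_ahead u.2.1 u.2.2 u.1.1).
apply: (@reach_ind _ _ P) => [|[[s q] [t p]] a [[s' q'] [t' p']] ru].
  left; split=> //; exists (start A); first exact: EmitsNil.
  exact: (@reach_start _ (sync A B)).
rewrite /P /= => H tr; have hd' := hd _ _ _ _ (reach_step iAs ru tr).
case: H => -[q0 ra]; subst.
- exact: (runs_ahead_step iAB AB ra tr).
- have := runs_ahead_step iBA (async_composable_sym AB) ra (sync_trans_swap tr).
  by case: hd' => ? []; auto.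
Qed.

Lemma reach_async_nil (Act : Type) (rhd : Act -> Act)
    (rhd_inj : injective rhd) (A B : iots_data Act) sA sB :
  is_iots A -> is_iots B -> async_composable rhd A B -> half_duplex rhd A B ->
  @reach Act (async rhd A B) ((sA, [::]), (sB, [::])) ->
  @reach Act (sync A B) (sA, sB).
Proof.
move=> iA iB AB hd /(reach_async_runs_ahead rhd_inj iA iB AB hd).
case: (AB) => cAB _; case=> -[_ [r em rr]].
- by apply: reach_emits_nil em => //; apply: is_iots_sync.
- apply/reach_sync_swap/reach_emits_nil/em => //.
  by apply: is_iots_sync => //; apply: composable_sym.
Qed.

(** * Asynchronous simulation of synchronous transitions *)

Lemma async_enqueue (Act : Type) (rhd : Act -> Act) (A B : iots_data Act)
    sA a sA' qA (u : state (omega rhd B A)) (oa : out_to A B a) :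
  async_composable rhd A B -> trans A sA a sA' ->
  trans (async rhd A B) ((sA, qA), u) (rhd a)
    ((sA', rcons qA (exist _ a (mem_set oa))), u).
Proof.
move=> AB tr; apply: SyncLeft; last first.
  exact: (OmegaEnqueue rhd (a := exist _ a (mem_set oa))).
by apply: rhd_nshared AB _; apply/shared_out_to; left.
Qed.

Lemma async_dequeue (Act : Type) (rhd : Act -> Act) (A B : iots_data Act)
    sA (a : out_to A B) qA u u' :
  trans (omega rhd B A) u (val a) u' ->
  trans (async rhd A B) ((sA, a :: qA), u) (val a) ((sA, qA), u').
Proof.
move=> tr; apply: SyncShared tr; first exact: (val_shared a).
exact: OmegaDequeue.
Qed.

(** A synchronization is simulated by enqueuing and delivering at once: in an empty queue the new
    element is also the head. *)
Lemma async_handshake (Act : Type) (rhd : Act -> Act) (rhd_inj : injective rhd)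
    (A B : iots_data Act) sA sB a sA' sB' :
  is_iots A -> is_iots B -> async_composable rhd A B ->
  out_to A B a -> trans A sA a sA' -> trans B sB a sB' ->
  @reach Act (async rhd A B) ((sA, [::]), (sB, [::])) ->
  @reach Act (async rhd A B) ((sA', [::]), (sB', [::])).
Proof.
move=> iA iB AB oa trA trB rs.
have iAs := is_iots_async rhd_inj iA iB AB.
have rs' := reach_step iAs rs (async_enqueue [::] (sB, [::]) oa AB trA).
apply: (reach_step iAs rs'); apply: async_dequeue; apply: OmegaMove => //.
exact: (out_to_nout_to iA oa).
Qed.

Lemma async_move (Act : Type) (rhd : Act -> Act) (A B : iots_data Act)
    sA qA u a sA' :
  ~ shared A B a -> trans A sA a sA' ->
  trans (async rhd A B) ((sA, qA), u) a ((sA', qA), u).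
Proof.
move=> nsh tr; apply: SyncLeft => //; apply: OmegaMove => // oa.
by apply: nsh; apply/shared_out_to; left.
Qed.

Lemma reach_sync_async (Act : Type) (rhd : Act -> Act)
    (rhd_inj : injective rhd) (A B : iots_data Act) sA sB :
  is_iots A -> is_iots B -> async_composable rhd A B ->
  @reach Act (sync A B) (sA, sB) ->
  @reach Act (async rhd A B) ((sA, [::]), (sB, [::])).
Proof.
move=> iA iB AB; have BA := async_composable_sym AB.
have iAs := is_iots_async rhd_inj iA iB AB.
pose P (u : state (sync A B)) :=
  @reach Act (async rhd A B) ((u.1, [::]), (u.2, [::])).
apply: (@reach_ind _ _ P); first exact: (@reach_start _ (async rhd A B)).
move=> u a u' _; rewrite /P => ru tr.
case: tr ru => /= [s b s' t nsh tr|s t b t' nsh tr|s t b s' t' sh trA trB] ru.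
- by apply: (reach_step iAs ru); apply: async_move tr.
- apply: (reach_step iAs ru); apply: sync_trans_swap; apply: async_move tr.
  by rewrite shared_sym.
- case/shared_out_to: sh => ob; first exact: (async_handshake rhd_inj) trB ru.
  by apply/reach_sync_swap/(async_handshake rhd_inj) => //;
    [exact: ob|exact: trB|exact: trA|apply: reach_sync_swap].
Qed.

(** * Progress granted by compatibility *)

Lemma receiver_progress (Act : Type) (rhd : Act -> Act) (A B : iots_data Act)
    sA (a : out_to A B) qA u :
  weakly_async_compatible rhd A B ->
  @reach Act (async rhd A B) ((sA, a :: qA), u) ->
  exists b u', trans (omega rhd B A) u b u' /\
    (b = val a \/ internal (omega rhd B A) b).
Proof.
move=> [_ cA _] ru.
have [u1 [u2 [st tr]]] := cA _ _ _ _ ru (set_valP a) (OmegaDequeue rhd sA a qA).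
(* Only the first step of the receiver is kept: the reception itself if the internal run is empty,
   an internal step otherwise. *)
case: st tr => [tr|u0 u1' [b ib trb] _ _].
- by exists (val a), u2; split=> //; left.
- by exists b, u0; split=> //; right.
Qed.

Lemma async_progress_cons (Act : Type) (rhd : Act -> Act)
    (A B : iots_data Act) sA (a : out_to A B) qA u :
  is_iots A -> is_iots B -> async_composable rhd A B ->
  weakly_async_compatible rhd A B ->
  @reach Act (async rhd A B) ((sA, a :: qA), u) ->
  exists b v, trans (async rhd A B) ((sA, a :: qA), u) b v.
Proof.
move=> iA iB AB cAB ru.
have [b [u' [tr [eb|ib]]]] := receiver_progress cAB ru.
- by subst; exists (val a), ((sA, qA), u'); apply: async_dequeue.
- exists b, ((sA, a :: qA), u'); apply: SyncRight tr.
  rewrite shared_sym; apply: internal_nshared ib.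
  exact/is_iots_omega/async_composable_sym.
Qed.

Lemma sync_progress_enqueue (Act : Type) (rhd : Act -> Act)
    (rhd_inj : injective rhd) (A B : iots_data Act) sA sB a sA' :
  is_iots A -> is_iots B -> async_composable rhd A B ->
  weakly_async_compatible rhd A B -> half_duplex rhd A B ->
  @reach Act (async rhd A B) ((sA, [::]), (sB, [::])) ->
  out_to A B a -> trans A sA a sA' ->
  exists b v, trans (sync A B) (sA, sB) b v.
Proof.
move=> iA iB AB cAB hd rs oa trA.
have BA := async_composable_sym AB.
have iAs := is_iots_async rhd_inj iA iB AB.
(* Compatibility of the queue extensions speaks of outputs that leave a queue, so [a] is enqueued
   first. *)
have rs' := reach_step iAs rs (async_enqueue [::] (sB, [::]) oa AB trA).
have [b [u' [tr eb]]] := receiver_progress cAB rs'.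
inversion tr as [? ? sB' ? trB nob|? c sB' ? trB|]; subst.
- case: eb => [eb|[ib|[c oc ec]]].
  + rewrite /= in eb; subst; exists a, (sA', sB'); apply: SyncShared trB => //.
    by apply/shared_out_to; left.
  + exists b, (sA, sB'); apply: SyncRight trB.
    by rewrite shared_sym; apply: internal_nshared ib.
  + exists b, (sA, sB'); apply: SyncRight trB; rewrite -ec.
    by apply: rhd_nshared AB _; apply/shared_out_to; right.
(* If the receiver progresses by enqueuing [c], both queues become nonempty, against
   half-duplexity. *)
- have oc : out_to B A (val c) := set_valP c.
  have st := sync_trans_swap (async_enqueue [::] (sA', [:: exist _ a (mem_set oa)]) oc BA trB).
  by case: (hd _ _ _ _ (reach_step iAs rs' st)).
Qed.

Lemma sync_progress_omega (Act : Type) (rhd : Act -> Act)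
    (rhd_inj : injective rhd) (A B : iots_data Act) sA sB a v :
  is_iots A -> is_iots B -> async_composable rhd A B ->
  weakly_async_compatible rhd A B -> half_duplex rhd A B ->
  @reach Act (async rhd A B) ((sA, [::]), (sB, [::])) ->
  ~ shared A B a -> trans (omega rhd A B) (sA, [::]) a v ->
  exists b v, trans (sync A B) (sA, sB) b v.
Proof.
move=> iA iB AB cAB hd rs nsh tr.
inversion tr as [? ? sA' ? trA _|? c sA' ? trA|]; subst.
- by exists a, (sA', sB); apply: SyncLeft trA.
- exact: (sync_progress_enqueue rhd_inj iA iB AB cAB hd rs (set_valP c) trA).
Qed.

(** An output to the partner appears only when dequeued. Hence no shared action is possible while
    both queues are empty. *)
Lemma omega_nil_nout_to (Act : Type) (rhd : Act -> Act) (A B : iots_data Act)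
    s a v :
  async_composable rhd A B -> trans (omega rhd A B) (s, [::]) a v ->
  ~ out_to A B a.
Proof.
move=> AB tr oa; inversion tr as [|? c|]; subst => //.
apply: (rhd_nshared AB (val_shared c)).
by apply/shared_out_to; left.
Qed.

Theorem theorem6p3 (Act : Type) (rhd : Act -> Act) (rhd_inj : injective rhd)
    (A B : iots Act)
    (AB_async : async_composable rhd A B)
    (AB_compat : weakly_async_compatible rhd A B)
    (AB_hd : half_duplex rhd A B) :
  sync_deadlock_free A B <-> async_deadlock_free rhd A B.
Proof.
have [iA iB] := (iotsP A, iotsP B).
have BA := async_composable_sym AB_async.
have cBA := weakly_sync_compatible_sym AB_compat.
split=> /deadlock_freeP df; apply/deadlock_freeP.
- move=> [[sA [|a qA]] [sB qB]] ru; last exact: async_progress_cons ru.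
  case: qB ru => [|b qB] ru; last first.
    have [c [[v1 v2] tr]] := async_progress_cons iB iA BA cBA (reach_sync_swap ru).
    by exists c, (v2, v1); apply: sync_trans_swap.
  have [a [v tr]] := df _ (reach_async_nil rhd_inj iA iB AB_async AB_hd ru).
  inversion tr as [? ? sA' ? nsh trA|? ? ? sB' nsh trB|? ? ? sA' sB' sh trA trB];
    subst.
  + by exists a, ((sA', [::]), (sB, [::])); apply: async_move trA.
  + exists a, ((sA, [::]), (sB', [::])); apply: sync_trans_swap.
    by apply: async_move trB; rewrite shared_sym.
  (* Of a synchronization only the sender's half is needed, as an enqueuing. *)
  + case/shared_out_to: sh => oa; exists (rhd a); eexists.
      exact: (async_enqueue _ _ oa AB_async trA).
    exact: (sync_trans_swap (async_enqueue _ _ oa BA trB)).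
- move=> [sA sB] /(reach_sync_async rhd_inj iA iB AB_async) ru.
  have [a [v tr]] := df _ ru.
  inversion tr as [? ? ? ? nsh trA|? ? ? ? nsh trB|? ? ? ? ? sh trA trB]; subst.
  + exact: (sync_progress_omega rhd_inj iA iB AB_async AB_compat AB_hd ru nsh trA).
  + have nsh' : ~ shared B A a by rewrite shared_sym.
    have [c [[v1 v2] tr']] := sync_progress_omega rhd_inj iB iA BA cBA
      (half_duplex_sym AB_hd) (reach_sync_swap ru) nsh' trB.
    by exists c, (v2, v1); apply: sync_trans_swap.
  + case/shared_out_to: sh => oa.
      by case: (omega_nil_nout_to AB_async trA).
    by case: (omega_nil_nout_to BA trB).
Qed.
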